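(* Let $S$ be a set, $K:S\times S\to\mathbb{C}$ a positive definite kernel, $(B,\mathscr{B},\mu)$ a probability space and $\{k_s\}_{s\in S}\subset L^2(\mu)$ a family such that $K(s,t)=\int_B k_s(x)\overline{k_t(x)}\,d\mu(x)$ for all $(s,t)\in S\times S$. Let $\mathscr{H}(K)$ be the reproducing kernel Hilbert space of $K$, with kernel functions $K_s:=K(s,\cdot)$, $s\in S$. Then the assignment $$W(K_s):=k_s\in L^2(\mu),\quad s\in S,$$ extends by linearity (and continuity) to an isometry $W:\mathscr{H}(K)\to L^2(\mu)$. Its adjoint $V:=W^*:L^2(\mu)\to\mathscr{H}(K)$ is the transform $$(Vf)(s)=\int_B f(x)\overline{k_s(x)}\,d\mu(x),\quad f\in L^2(\mu),\ s\in S.$$ Moreover $W^*W=VW=I_{\mathscr{H}(K)}$, while $WW^*=WV$ is a projection in the Hilbert space $L^2(\mu)$.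
   Context: A kernel $K:S\times S\to\mathbb{C}$ is positive definite if for all $N\in\mathbb{N}$, $s_1,\dots,s_N\in S$ and $\xi_1,\dots,\xi_N\in\mathbb{C}$ one has $\sum_{i}\sum_{j}\xi_i\overline{\xi_j}K(s_i,s_j)\geq 0$. Inner products are linear in the first variable and conjugate-linear in the second. The reproducing kernel Hilbert space $\mathscr{H}(K)$ is the Hilbert space of functions on $S$ obtained as the completion of $\mathrm{span}\{K_s: s\in S\}$, $K_s=K(s,\cdot)$, with respect to the inner product $\langle\sum_i\xi_iK_{s_i},\sum_j\eta_jK_{s_j}\rangle_{\mathscr{H}(K)}=\sum_i\sum_j\xi_i\overline{\eta_j}K(s_i,s_j)$; it satisfies the reproducing property $f(s)=\langle f,K_s\rangle_{\mathscr{H}(K)}$ for all $s\in S$, $f\in\mathscr{H}(K)$. *)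

(* Defs.v *)
From HB Require Import structures.
From mathcomp Require Import all_boot all_order all_algebra.
From mathcomp Require Import complex ring.
From mathcomp Require Import all_classical all_reals all_analysis.
From mathcomp Require Import measurable_realfun.

Set Implicit Arguments.
Unset Strict Implicit.
Unset Printing Implicit Defensive.

Import Order.TTheory GRing.Theory Num.Theory.
Import numFieldNormedType.Exports.
Local Open Scope classical_set_scope.
Local Open Scope ring_scope.

Section SemiInner.
Variable C : numClosedFieldType.

Let form_discriminant (A D z : C) : 0 <= A -> 0 <= D ->
  (forall c, 0 <= A + c^* * z + c * z^* + c * c^* * D) ->
  `|z| ^+ 2 <= A * D.
Proof.
move=> A0 D0 H; have [D00|Dn0] := eqVneq D 0.
  have [->|zn0] := eqVneq z 0; first by rewrite normr0 expr0n mulr_ge0.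
  have n0 : `|z| ^+ 2 != 0 by rewrite expf_neq0 // normr_eq0.
  pose x := (A + 1) / `|z| ^+ 2.
  have xr : x^* = x.
    by apply: conj_Creal; rewrite ger0_real // divr_ge0 ?addr_ge0 ?exprn_ge0.
  have := H (- x * z); rewrite D00 mulr0 addr0 rmorphM rmorphN /= xr.
  have -> : A + - x * z^* * z + - x * z * z^* = A - (x * `|z| ^+ 2) *+ 2.
    by rewrite normCK; ring.
  rewrite divfK // => h.
  have : 0 < (A + 1) *+ 2 - A.
    by rewrite mulr2n -addrA [X in _ + X]addrAC subrr add0r ltr_wpDl ?addr_ge0.
  by rewrite -oppr_lt0 opprB => /lt_geF; rewrite h.
have Dp : 0 < D by rewrite lt_def Dn0.
have Dr : D^* = D by apply: conj_Creal; rewrite ger0_real.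
have := H (- z / D).
rewrite rmorphM rmorphN fmorphV /= Dr.
have -> : A + - z^* / D * z + - z / D * z^* + - z / D * (- z^* / D) * D =
   (A * D - `|z| ^+ 2) / D.
  by rewrite normCK; field.
by rewrite pmulr_lge0 ?invr_gt0 // subr_ge0.
Qed.


Variables (T : Type) (comb : C -> T -> T -> T) (B : T -> T -> C).
Hypothesis Bl : forall a u v w, B (comb a u v) w = a * B u w + B v w.
Hypothesis Bc : forall u v, B u v = (B v u)^*.
Hypothesis B0 : forall u, 0 <= B u u.

Let N u := sqrtC (B u u).

Lemma form_CauchySchwarz u v : `|B u v| <= N u * N v.
Proof.
have N0 w : 0 <= N w by rewrite sqrtC_ge0.
rewrite -(@ler_pXn2r _ 2) ?nnegrE ?mulr_ge0 // exprMn !sqrtCK.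
apply: form_discriminant => // c.
have := B0 (comb c v u); rewrite Bl Bc [B u (comb _ _ _)]Bc !Bl.
rewrite !rmorphD !rmorphM /= -![(B _ _)^*]Bc.
set t := (X in 0 <= X); set t' := (X in _ -> 0 <= X); suff -> : t = t' by [].
by rewrite /t /t' (Bc v u); ring.
Qed.

Lemma form_norm_comb a u v : N (comb a u v) <= `|a| * N u + N v.
Proof.
have N0 w : 0 <= N w by rewrite sqrtC_ge0.
rewrite -(@ler_pXn2r _ 2) ?nnegrE ?addr_ge0 ?mulr_ge0 // sqrrD exprMn !sqrtCK.
have -> : B (comb a u v) (comb a u v) =
    `|a| ^+ 2 * B u u + (a * B u v + (a * B u v)^*) + B v v.
  rewrite Bl [B u (comb _ _ _)]Bc [B v (comb _ _ _)]Bc !Bl.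
  by rewrite !rmorphD !rmorphM /= -!Bc normCK (Bc v u); ring.
rewrite lerD2r lerD2l -mulrA.
set z := a * B u v.
have zr : z + z^* \is Num.real by rewrite CrealE rmorphD /= conjCK addrC.
apply: le_trans (real_ler_norm zr) _; apply: le_trans (ler_normD _ _) _.
rewrite norm_conjC -mulr2n lerMn2r /= normrM ler_wpM2l //.
exact: form_CauchySchwarz.
Qed.

End SemiInner.

HB.mixin Record NormedModule_isPreHilbert (C : numClosedFieldType) V
    & NormedModule C V := {
  inner : V -> V -> C;
  inner_linear : forall a u v w, inner (a *: u + v) w = a * inner u w + inner v w;
  innerC : forall u v, inner u v = (inner v u)^*;
  inner_norm : forall u, inner u u = `|u| ^+ 2
}.

#[short(type="preHilbertType")]
HB.structure Definition PreHilbert (C : numClosedFieldType) :=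
  {V of NormedModule_isPreHilbert C V & NormedModule C V}.

HB.factory Record Lmodule_isPreHilbert (C : numClosedFieldType) V
    & GRing.Lmodule C V := {
  inner : V -> V -> C;
  inner_linear : forall a u v w, inner (a *: u + v) w = a * inner u w + inner v w;
  innerC : forall u v, inner u v = (inner v u)^*;
  inner_ge0 : forall u, 0 <= inner u u;
  inner_eq0 : forall u, inner u u = 0 -> u = 0
}.

HB.builders Context C V & Lmodule_isPreHilbert C V.

Let nrm (u : V) := sqrtC (inner u u).

Let nrmD u v : nrm (u + v) <= nrm u + nrm v.
Proof.
have := form_norm_comb inner_linear innerC inner_ge0 1 u v.
by rewrite scale1r normr1 mul1r.
Qed.

Let nrmZ a u : nrm (a *: u) = `|a| * nrm u.
Proof.
have inner0l w : inner 0 w = 0.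
  have := inner_linear (-1) 0 0 w.
  by rewrite scaler0 addr0 mulN1r addNr.
have innerZ b v w : inner (b *: v) w = b * inner v w.
  by rewrite -[b *: v]addr0 inner_linear inner0l addr0.
rewrite /nrm innerZ [inner u _]innerC innerZ rmorphM /= -innerC mulrA -normCK.
by rewrite sqrtCM ?nnegrE ?exprn_ge0 ?inner_ge0 // sqrCK.
Qed.

Let nrm_eq0 u : nrm u = 0 -> u = 0.
Proof. by move/eqP; rewrite sqrtC_eq0 => /eqP /inner_eq0. Qed.

HB.instance Definition _ := Lmodule_isNormed.Build C V nrmD nrmZ nrm_eq0.

Let inner_nrm u : inner u u = `|u| ^+ 2.
Proof. by rewrite [`|u|]/(nrm u) sqrtCK. Qed.

HB.instance Definition _ :=
  NormedModule_isPreHilbert.Build C V inner_linear innerC inner_nrm.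

HB.end.

(* The field R[i], as one constant: with a bare R[i] the canonical structures of
   the spaces below take minutes to infer. *)
Definition Cx (R : realType) : numClosedFieldType := R[i].

Section Kernel.
Variables (R : realType) (S : Type).
Local Notation C := (Cx R).

(* In the order of R[i], 0 <= z means that z is real and nonnegative. *)
Definition positive_definite (K : S -> S -> C) :=
  forall (N : nat) (s : 'I_N -> S) (xi : 'I_N -> C),
    0 <= \sum_(i < N) \sum_(j < N) xi i * (xi j)^* * K (s i) (s j).

Variable K : S -> S -> C.
Implicit Types (a b : seq (C * S)) (u v : nat -> seq (C * S)).

(* A list [:: (xi_1, s_1); ...; (xi_n, s_n)] encodes sum_i xi_i K_{s_i}. *)
Definition kcomb a (t : S) : C := \sum_(p <- a) p.1 * K p.2 t.

Definition kform a b : C :=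
  \sum_(p <- a) \sum_(q <- b) p.1 * (q.1)^* * K p.2 q.2.

Definition knorm a : C := sqrtC (kform a a).

(* Encodes x a + b; in particular klin (-1) b a encodes a - b. *)
Definition klin (x : C) a b := [seq (x * p.1, p.2) | p <- a] ++ b.

Definition kcauchy u := forall e : C, 0 < e -> exists N : nat,
  forall m n, (N <= m)%N -> (N <= n)%N -> knorm (klin (-1) (u n) (u m)) < e.

(* Convergence in norm implies pointwise convergence, so an element of the
   completion of the span of the K_s is identified with the pointwise limit of a
   Cauchy sequence of that span. *)
Definition kapprox u (f : S -> C) :=
  kcauchy u /\ forall t, (fun n => kcomb (u n) t : C^o) @ \oo --> (f t : C^o).

Lemma kcomb_lin x a b t : kcomb (klin x a b) t = x * kcomb a t + kcomb b t.
Proof.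
rewrite /kcomb big_cat big_map /= mulr_sumr; congr (_ + _).
by apply: eq_bigr => p _; rewrite mulrA.
Qed.

Lemma kform_linl x a b c : kform (klin x a b) c = x * kform a c + kform b c.
Proof.
rewrite /kform big_cat big_map /= mulr_sumr; congr (_ + _).
by apply: eq_bigr => p _; rewrite mulr_sumr; apply: eq_bigr => q _; rewrite !mulrA.
Qed.

Lemma kform_comb a b : kform a b = \sum_(q <- b) (q.1)^* * kcomb a q.2.
Proof.
rewrite /kform exchange_big; apply: eq_bigr => q _.
by rewrite mulr_sumr; apply: eq_bigr => p _; rewrite mulrA [_^* * _]mulrC.
Qed.

Hypothesis hK : positive_definite K.

Lemma kform_ge0 a : 0 <= kform a a.
Proof.
have := hK (fun i : 'I_(size a) => (tnth (in_tuple a) i).2)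
           (fun i : 'I_(size a) => (tnth (in_tuple a) i).1).
rewrite /kform (big_tnth _ _ a) /=.
by under [X in _ -> 0 <= X]eq_bigr => i _ do rewrite (big_tnth _ _ a).
Qed.

Lemma kernelC s t : K s t = (K t s)^*.
Proof.
have q x y : x * x^* * K s s + x * y^* * K s t + y * x^* * K t s + y * y^* * K t t
   \is Num.real.
  have := kform_ge0 [:: (x, s); (y, t)].
  rewrite /kform !big_cons !big_nil /= !addr0 addrA => h.
  exact: ger0_real h.
have r1 x : K x x \is Num.real.
  have := kform_ge0 [:: (1, x)].
  rewrite /kform !big_cons !big_nil /= !addr0 conjC1 !mul1r => h.
  exact: ger0_real h.
have := q 1 1; have := q 1 'i; rewrite conjC1 conjCi !mul1r !mulr1.
have -> : 'i * - 'i = 1 :> C by rewrite mulrN -expr2 sqrCi opprK.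
rewrite mul1r rpredDr ?r1 // -addrA rpredDl ?r1 //.
move=> /CrealP; rewrite rmorphD !rmorphM rmorphN /= conjCi opprK => h1.
rewrite rpredDr ?r1 // -addrA rpredDl ?r1 //.
move=> /CrealP; rewrite rmorphD /= => h2.
have h3 : (K s t)^* - (K t s)^* = K t s - K s t.
  apply: (mulfI (neq0Ci C)).
  by rewrite !mulrBr -mulNr h1 mulNr addrC.
rewrite -[LHS]conjCK; congr (_^*); apply: (@mulfI _ 2); first by rewrite pnatr_eq0.
transitivity (((K s t)^* + (K t s)^*) + ((K s t)^* - (K t s)^*)); first by ring.
by rewrite h2 h3; ring.
Qed.

End Kernel.

Section ComplexSequences.
Variable R : realType.
Local Notation C := (Cx R).
Implicit Types (z : nat -> C) (l : C).

Lemma cvgCP z l : (z : nat -> C^o) @ \oo --> (l : C^o) <->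
  (forall e : C, 0 < e -> exists N, forall n, (N <= n)%N -> `|l - z n| < e).
Proof.
split=> [/cvgrPdist_lt zl e e0|zl].
  by have [N _ h] := zl _ e0; exists N => n Nn; apply: h.
apply/cvgrPdist_lt => e e0; have [N h] := zl _ e0.
by exists N => // n /= /h.
Qed.

Lemma cvgC_ext z z' l : z' =1 z -> (z : nat -> C^o) @ \oo --> (l : C^o) ->
  (z' : nat -> C^o) @ \oo --> (l : C^o).
Proof. by move=> /funext ->. Qed.

Lemma cvgC_unique z l l' : (z : nat -> C^o) @ \oo --> (l : C^o) ->
  (z : nat -> C^o) @ \oo --> (l' : C^o) -> l = l'.
Proof.
move=> zl zl'; exact: (cvg_unique (@norm_hausdorff _ C^o) zl zl').
Qed.

Lemma cvgC_conj z l : (z : nat -> C^o) @ \oo --> (l : C^o) ->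
  ((fun n => (z n)^*) : nat -> C^o) @ \oo --> (l^* : C^o).
Proof.
move=> /cvgCP zl; apply/cvgCP => e /zl[N h]; exists N => n /h.
by rewrite -rmorphB norm_conjC.
Qed.

Lemma cvgC_lin x z z' l l' : (z : nat -> C^o) @ \oo --> (l : C^o) ->
  (z' : nat -> C^o) @ \oo --> (l' : C^o) ->
  ((fun n => x * z n + z' n) : nat -> C^o) @ \oo --> (x * l + l' : C^o).
Proof. by move=> zl zl'; exact: (cvgD (cvgZl_tmp (k := x) zl) zl'). Qed.

Lemma cvgC_ge0 z l : (forall n, 0 <= z n) -> (z : nat -> C^o) @ \oo --> (l : C^o) ->
  0 <= l.
Proof.
move=> z0 zl; have lr : l \is Num.real.
  apply/CrealP; apply: cvgC_unique (cvgC_conj zl) _.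
  by apply: cvgC_ext zl => n; rewrite (conj_Creal (ger0_real (z0 n))).
rewrite real_leNgt ?real0 //; apply/negP => l0.
have /cvgCP /(_ (- l)) := zl; rewrite oppr_gt0 => /(_ l0)[N /(_ N (leqnn _))].
rewrite -normrN opprB ger0_norm ?subr_ge0 ?(le_trans (ltW l0)) //.
by rewrite gtrDr => /lt_geF; rewrite z0.
Qed.

Lemma cvgC_complete z : (forall e : C, 0 < e -> exists N, forall m n,
    (N <= m)%N -> (N <= n)%N -> `|z m - z n| < e) ->
  exists l, (z : nat -> C^o) @ \oo --> (l : C^o).
Proof.
move=> zc.
have part (p : C -> R) : (forall x y, p (x - y) = p x - p y) ->
    (forall x, (`|p x|%:C)%C <= `|x|) ->
    exists l : R, forall e, 0 < e ->
      exists N, forall n, (N <= n)%N -> `|l - p (z n)| < e.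
  move=> pB pn.
  have /cauchy_cvgP/cvg_ex[l /= /cvgrPdist_lt lP] : cauchy ((p \o z : nat -> R^o) @ \oo).
    apply: cauchy_exP => e e0.
    have [|N hN] := zc (e%:C)%C; first by rewrite ltcR.
    exists (p (z N)), N => // n /= Nn.
    by rewrite /ball /= -pB -ltcR (le_lt_trans (pn _)) ?hN.
  exists l => e e0; have [N _ h] := lP _ e0.
  by exists N => n Nn; apply: h.
have Im_le (x : C) : (`|complex.Im x|%:C)%C <= `|x|.
  have := normc_ge_Re ('i%C * x).
  by rewrite mulrC ReiNIm normrN normrM complexiE normCi mulr1.
have [|a za] := part (@complex.Re R) _ (@normc_ge_Re R); first by case=> ? ? [].
have [|b zb] := part (@complex.Im R) _ Im_le; first by case=> ? ? [].
exists (a +i* b)%C; apply/cvgCP => e.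
rewrite ltcE => /andP[/eqP /= e2 e1].
have [|N1 h1] := za (complex.Re e / 2); first by rewrite divr_gt0.
have [|N2 h2] := zb (complex.Re e / 2); first by rewrite divr_gt0.
exists (maxn N1 N2) => n; rewrite geq_max => /andP[/h1 n1 /h2 n2].
have -> : e = ((complex.Re e / 2 + complex.Re e / 2)%:C)%C.
  by rewrite -splitr [LHS]complexE e2 mulr0 addr0.
have -> : (a +i* b)%C - z n = ((a - complex.Re (z n))%:C)%C
    + 'i%C * ((b - complex.Im (z n))%:C)%C.
  by rewrite [LHS]complexE; case: (z n).
rewrite (le_lt_trans (ler_normD _ _)) // normrM complexiE normCi mul1r.
have normR (x : R) : `|x%:C%C| = (`|x|%:C)%C :> C.
  by rewrite normc_def /= expr0n /= addr0 sqrtr_sqr.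
by rewrite !normR -rmorphD ltcR ltrD.
Qed.

End ComplexSequences.

Section KernelCompletion.
Variables (R : realType) (S : Type) (K : S -> S -> Cx R).
Hypothesis hK : positive_definite K.
Local Notation C := (Cx R).
Implicit Types (a b : seq (C * S)) (u v : nat -> seq (C * S)) (f g h : S -> C).

Lemma kformC a b : kform K a b = (kform K b a)^*.
Proof.
rewrite /kform rmorph_sum exchange_big /=; apply: eq_bigr => q _.
rewrite rmorph_sum; apply: eq_bigr => p _.
by rewrite !rmorphM /= conjCK -(kernelC hK) [p.1 * _]mulrC.
Qed.

Lemma kform_linr x a b c :
  kform K c (klin x a b) = x^* * kform K c a + kform K c b.
Proof. by rewrite kformC kform_linl rmorphD rmorphM /= -!kformC. Qed.

Lemma knorm_ge0 a : 0 <= knorm K a.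
Proof. by rewrite sqrtC_ge0 kform_ge0. Qed.

Lemma kform_le a b : `|kform K a b| <= knorm K a * knorm K b.
Proof. exact: (form_CauchySchwarz (kform_linl K) kformC (kform_ge0 hK)). Qed.

Lemma knorm_lin x a b : knorm K (klin x a b) <= `|x| * knorm K a + knorm K b.
Proof. exact: (form_norm_comb (kform_linl K) kformC (kform_ge0 hK)). Qed.

Lemma knorm_sub a b : knorm K a <= knorm K (klin (-1) b a) + knorm K b.
Proof.
rewrite addrC -[knorm K b]mul1r -[X in X * _]normr1.
apply: le_trans (knorm_lin 1 b (klin (-1) b a)).
suff -> : knorm K a = knorm K (klin 1 b (klin (-1) b a)) by [].
rewrite /knorm !(kform_linl, kform_linr) !rmorphN !conjC1; congr sqrtC; ring.
Qed.

Lemma kcauchy_bounded u : kcauchy K u ->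
  exists2 M : C, 0 < M & exists N, forall n, (N <= n)%N -> knorm K (u n) <= M.
Proof.
move=> /(_ 1 ltr01)[N uN]; exists (1 + knorm K (u N)).
  by rewrite ltr_wpDr ?knorm_ge0.
exists N => n Nn; apply: le_trans (knorm_sub _ (u N)) _.
by rewrite lerD2r ltW ?uN.
Qed.

Lemma kcauchy_lin x u v : kcauchy K u -> kcauchy K v ->
  kcauchy K (fun n => klin x (u n) (v n)).
Proof.
move=> uc vc e e0.
have x1 : 0 < `|x| + 1 by rewrite ltr_wpDl.
have [|N1 h1] := uc (e / 2 / (`|x| + 1)); first by rewrite !divr_gt0.
have [|N2 h2] := vc (e / 2); first by rewrite divr_gt0.
exists (maxn N1 N2) => m n; rewrite !geq_max => /andP[m1 m2] /andP[n1 n2].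
have -> : knorm K (klin (-1) (klin x (u n) (v n)) (klin x (u m) (v m))) =
    knorm K (klin x (klin (-1) (u n) (u m)) (klin (-1) (v n) (v m))).
  by rewrite /knorm !(kform_linl, kform_linr); congr sqrtC; ring.
apply: le_lt_trans (knorm_lin _ _ _) _.
rewrite [ltRHS]splitr; apply: ler_ltD; last exact: h2.
apply: (@le_trans _ _ ((`|x| + 1) * knorm K (klin (-1) (u n) (u m)))).
  by rewrite ler_wpM2r ?knorm_ge0 // lerDl.
by rewrite mulrC -ler_pdivlMr // ltW // h1.
Qed.

Lemma kapprox_lin x u v f g : kapprox K u f -> kapprox K v g ->
  kapprox K (fun n => klin x (u n) (v n)) (x *: f + g).
Proof.
move=> [uc uf] [vc vg]; split=> [|t]; first exact: kcauchy_lin.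
apply: cvgC_ext => [n|]; first by rewrite kcomb_lin.
exact: (cvgC_lin (x := x) (uf t) (vg t)).
Qed.

Lemma kapprox_ker s : kapprox K (fun=> [:: (1, s)]) (K s).
Proof.
split=> [e e0|t].
  exists 0%N => m n _ _.
  rewrite /knorm (_ : kform K _ _ = 0) ?sqrtC0 //.
  by rewrite !(kform_linl, kform_linr) rmorphN /= conjC1; ring.
apply: (@cvgC_ext _ (fun=> K s t)); last exact: cvg_cst.
by move=> _; rewrite /kcomb big_cons big_nil addr0 mul1r.
Qed.

Lemma kform_cvg_comb u f b : kapprox K u f ->
  (fun n => kform K (u n) b : C^o) @ \oo -->
  (\sum_(q <- b) (q.1)^* * f q.2 : C^o).
Proof.
move=> [_ uf]; apply: cvgC_ext => [n|]; first by rewrite kform_comb.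
elim: b => [|q b IHb].
  rewrite big_nil; apply: (@cvgC_ext _ (fun=> 0)); last exact: cvg_cst.
  by move=> n; rewrite big_nil.
apply: cvgC_ext => [n|]; rewrite big_cons; first by [].
exact: (cvgC_lin (x := (q.1)^*) (uf q.2) IHb).
Qed.

Lemma kapprox0 u : kapprox K u (fun=> 0) ->
  forall e : C, 0 < e -> exists N, forall n, (N <= n)%N -> knorm K (u n) < e.
Proof.
move=> u0 e e0; have [uc _] := u0.
have [M M0 [N0 uM]] := kcauchy_bounded uc.
have e20 : 0 < e ^+ 2 / 2 by rewrite divr_gt0 ?exprn_gt0.
have [|N1 h1] := uc (e ^+ 2 / 2 / M); first by rewrite divr_gt0.
have /cvgCP /(_ _ e20)[N2 h2] := kform_cvg_comb (b := u N1) u0.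
exists (maxn N0 (maxn N1 N2)) => n; rewrite !geq_max => /and3P[n0 n1 n2].
rewrite -(@ltr_pXn2r _ 2) ?nnegrE ?knorm_ge0 ?(ltW e0) //.
rewrite sqrtCK.
have -> : kform K (u n) (u n) =
    kform K (klin (-1) (u N1) (u n)) (u n) + (kform K (u n) (u N1))^*.
  by rewrite kform_linl -kformC; ring.
rewrite -[ltLHS]ger0_norm; last first.
  by rewrite kform_linl -kformC mulN1r addrAC addNr add0r kform_ge0.
apply: le_lt_trans (ler_normD _ _) _; rewrite [ltRHS]splitr norm_conjC.
apply: ler_ltD; last first.
  have := h2 _ n2; rewrite big1 ?sub0r ?normrN // => q _; exact: mulr0.
apply: le_trans (kform_le _ _) _.
apply: (@le_trans _ _ (e ^+ 2 / 2 / M * M)); last by rewrite divfK ?gt_eqF.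
by apply: ler_pM; rewrite ?knorm_ge0 ?uM // ltW // h1.
Qed.

Lemma kform_cvg0 u v : kapprox K u (fun=> 0) -> kcauchy K v ->
  (fun n => kform K (u n) (v n) : C^o) @ \oo --> (0 : C^o).
Proof.
move=> u0 vc; apply/cvgCP => e e0.
have [M M0 [N0 vM]] := kcauchy_bounded vc.
have [|N1 h1] := kapprox0 u0 (e := e / M); first by rewrite divr_gt0.
exists (maxn N0 N1) => n; rewrite geq_max => /andP[n0 n1].
rewrite sub0r normrN; apply: le_lt_trans (kform_le _ _) _.
apply: (@le_lt_trans _ _ (knorm K (u n) * M)).
  by rewrite ler_wpM2l ?knorm_ge0 ?vM.
by rewrite -ltr_pdivlMr ?h1.
Qed.

Lemma kform_cvg u v : kcauchy K u -> kcauchy K v ->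
  exists l : C, (fun n => kform K (u n) (v n) : C^o) @ \oo --> (l : C^o).
Proof.
move=> uc vc; apply: cvgC_complete => e e0.
have [M M0 [N0 uM]] := kcauchy_bounded uc.
have [M' M'0 [N1 vM]] := kcauchy_bounded vc.
have [|N2 h2] := uc (e / 2 / M'); first by rewrite !divr_gt0.
have [|N3 h3] := vc (e / 2 / M); first by rewrite !divr_gt0.
exists (maxn (maxn N0 N1) (maxn N2 N3)) => m n; rewrite !geq_max.
move=> /andP[/andP[m0 m1] /andP[m2 m3]] /andP[/andP[n0 n1] /andP[n2 n3]].
have -> : kform K (u m) (v m) - kform K (u n) (v n) =
    kform K (klin (-1) (u n) (u m)) (v m) + kform K (u n) (klin (-1) (v n) (v m)).
  by rewrite kform_linl kform_linr rmorphN /= conjC1; ring.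
apply: le_lt_trans (ler_normD _ _) _; rewrite [ltRHS]splitr ltrD //.
- apply: le_lt_trans (kform_le _ _) _.
  apply: (@le_lt_trans _ _ (knorm K (klin (-1) (u n) (u m)) * M')).
    by rewrite ler_wpM2l ?knorm_ge0 ?vM.
  by rewrite -ltr_pdivlMr ?h2.
- apply: le_lt_trans (kform_le _ _) _; rewrite mulrC.
  apply: (@le_lt_trans _ _ (knorm K (klin (-1) (v n) (v m)) * M)).
    by rewrite ler_wpM2l ?knorm_ge0 ?uM.
  by rewrite -ltr_pdivlMr ?h3.
Qed.

Lemma kform_cvg_unique u u' v v' f g l : kapprox K u f -> kapprox K u' f ->
  kapprox K v g -> kapprox K v' g ->
  (fun n => kform K (u n) (v n) : C^o) @ \oo --> (l : C^o) ->
  (fun n => kform K (u' n) (v' n) : C^o) @ \oo --> (l : C^o).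
Proof.
have sub0 w w' h : kapprox K w h -> kapprox K w' h ->
    kapprox K (fun n => klin (-1) (w n) (w' n)) (fun=> 0).
  move=> wh w'h; have := kapprox_lin (-1) wh w'h.
  by rewrite scaleN1r addNr.
move=> uf u'f vg v'g uvl.
have d1 := kform_cvg0 (sub0 _ _ _ uf u'f) (v'g.1).
have d2 := cvgC_conj (kform_cvg0 (sub0 _ _ _ vg v'g) (uf.1)).
have := cvgC_lin (x := 1) d1 (cvgC_lin (x := 1) d2 uvl).
rewrite conjC0 !mulr0 !add0r; apply: cvgC_ext => n; rewrite -kformC.
by rewrite kform_linl kform_linr rmorphN /= conjC1; ring.
Qed.

End KernelCompletion.

Section Rkhs.
Variables (R : realType) (S : Type) (K : S -> S -> Cx R).
Local Notation C := (Cx R).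

Definition rkhs_pred : {pred S -> C} :=
  [pred f | `[< exists u, kapprox K u f >]].

(* The parameter hK is needed by the Hilbert structure: without it kform is not
   an inner product. *)
Record rkhs (hK : positive_definite K) : Type :=
  Rkhs { rkhs_fun :> S -> C ; _ : rkhs_fun \in rkhs_pred }.

Variable hK : positive_definite K.

HB.instance Definition _ := [isSub for @rkhs_fun hK].
HB.instance Definition _ := [Choice of rkhs hK by <:].

Lemma rkhs_predP f : reflect (exists u, kapprox K u f) (f \in rkhs_pred).
Proof. exact: asboolP. Qed.

Lemma rkhs_submod_closed : submod_closed rkhs_pred.
Proof.
split=> [|x f g].
  apply/rkhs_predP; exists (fun=> [::]); split=> [e e0|t].
    by exists 0%N => m n _ _; rewrite /knorm /kform big_nil sqrtC0.
  apply: (@cvgC_ext _ (fun=> 0)); last exact: cvg_cst.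
  by move=> n; rewrite /kcomb big_nil.
move=> /rkhs_predP[u uf] /rkhs_predP[v vg]; apply/rkhs_predP.
by exists (fun n => klin x (u n) (v n)); exact: kapprox_lin.
Qed.

HB.instance Definition _ :=
  GRing.isSubmodClosed.Build C (S -> C) rkhs_pred rkhs_submod_closed.
HB.instance Definition _ := [SubChoice_isSubLmodule of rkhs hK by <:].

Lemma rkhs_kapprox (f : rkhs hK) : exists u, kapprox K u f.
Proof. exact/rkhs_predP/(valP f). Qed.

Definition rkhs_approx (f : rkhs hK) : nat -> seq (C * S) :=
  sval (cid (rkhs_kapprox f)).

Lemma rkhs_approxP f : kapprox K (rkhs_approx f) f.
Proof. exact: (svalP (cid (rkhs_kapprox f))). Qed.

(* The extension of kform to the completion by continuity; by rkhs_inner_cvg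
   it does not depend on the choice of the approximating sequences. *)
Definition rkhs_inner (f g : rkhs hK) : C :=
  lim ((fun n => kform K (rkhs_approx f n) (rkhs_approx g n) : C^o) @ \oo).

Lemma rkhs_inner_cvg u v (f g : rkhs hK) : kapprox K u f -> kapprox K v g ->
  (fun n => kform K (u n) (v n) : C^o) @ \oo --> (rkhs_inner f g : C^o).
Proof.
move=> uf vg.
apply: (kform_cvg_unique hK (rkhs_approxP f) uf (rkhs_approxP g) vg).
have [l ul] := kform_cvg hK (rkhs_approxP f).1 (rkhs_approxP g).1.
by apply/cvg_ex; exists l.
Qed.

Lemma rkhs_inner_linear (x : C) (f g h : rkhs hK) :
  rkhs_inner (x *: f + g) h = x * rkhs_inner f h + rkhs_inner g h.
Proof.
have fgP := kapprox_lin hK x (rkhs_approxP f) (rkhs_approxP g).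
apply: cvgC_unique (rkhs_inner_cvg (f := x *: f + g) fgP (rkhs_approxP h)) _.
apply: cvgC_ext => [n|]; first by rewrite kform_linl.
by apply: cvgC_lin; exact: rkhs_inner_cvg (rkhs_approxP _) (rkhs_approxP _).
Qed.

Lemma rkhs_innerC (f g : rkhs hK) : rkhs_inner f g = (rkhs_inner g f)^*.
Proof.
apply: cvgC_unique (rkhs_inner_cvg (rkhs_approxP f) (rkhs_approxP g)) _.
apply: cvgC_ext => [n|]; first by rewrite (kformC hK).
exact: cvgC_conj (rkhs_inner_cvg (rkhs_approxP _) (rkhs_approxP _)).
Qed.

Lemma rkhs_inner_ge0 (f : rkhs hK) : 0 <= rkhs_inner f f.
Proof.
apply: cvgC_ge0 (rkhs_inner_cvg (rkhs_approxP f) (rkhs_approxP f)) => n.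
exact: kform_ge0.
Qed.

Lemma kernel_fun_subproof s : K s \in rkhs_pred.
Proof. by apply/rkhs_predP; eexists; exact: (kapprox_ker hK). Qed.

Definition kernel_fun (s : S) : rkhs hK := Rkhs hK (kernel_fun_subproof s).

Lemma rkhs_inner_kernel (f : rkhs hK) s : rkhs_inner f (kernel_fun s) = f s.
Proof.
apply: cvgC_unique
  (rkhs_inner_cvg (g := kernel_fun s) (rkhs_approxP f) (kapprox_ker hK s)) _.
have := kform_cvg_comb (b := [:: (1, s)]) (rkhs_approxP f).
by rewrite big_cons big_nil /= conjC1 mul1r addr0.
Qed.

Lemma rkhs_inner_eq0 (f : rkhs hK) : rkhs_inner f f = 0 -> f = 0.
Proof.
move=> f0; apply/val_inj/funext => s /=.
have := form_CauchySchwarz rkhs_inner_linear rkhs_innerC rkhs_inner_ge0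
  f (kernel_fun s).
by rewrite f0 sqrtC0 mul0r normr_le0 rkhs_inner_kernel => /eqP.
Qed.

End Rkhs.

HB.instance Definition _ (R : realType) (S : Type) (K : S -> S -> Cx R)
    (hK : positive_definite K) :=
  Lmodule_isPreHilbert.Build (Cx R) (rkhs hK)
  (@rkhs_inner_linear _ _ _ hK) (@rkhs_innerC _ _ _ hK) (@rkhs_inner_ge0 _ _ _ hK)
   (@rkhs_inner_eq0 _ _ _ hK).

Lemma rkhs_reproducing (R : realType) (S : Type) (K : S -> S -> Cx R)
    (hK : positive_definite K) (f : rkhs hK) s : f s = inner f (kernel_fun hK s).
Proof. by rewrite -rkhs_inner_kernel. Qed.


Section SquareIntegrable.
Context {d : measure_display} {B : measurableType d} {R : realType}.
Variable mu : {measure set B -> \bar R}.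
Local Notation C := (Cx R).
Implicit Types f g : B -> C.

Definition cintegral f : C :=
  ((\int[mu]_x complex.Re (f x)) +i* (\int[mu]_x complex.Im (f x)))%C.

Definition square_integrable f :=
  [/\ measurable_fun setT (fun x => complex.Re (f x)),
      measurable_fun setT (fun x => complex.Im (f x)) &
      (\int[mu]_x (complex.Re (`|f x| ^+ 2))%:E < +oo)%E].

Lemma Re_normc2 (z : C) :
  complex.Re (`|z| ^+ 2) = complex.Re z ^+ 2 + complex.Im z ^+ 2.
Proof. by rewrite -(add_Re2_Im2 (z : R[i])). Qed.

Lemma Re_lin (x z w : C) : complex.Re (x * z + w) =
  complex.Re x * complex.Re z + (- complex.Im x) * complex.Im z + complex.Re w.
Proof. by rewrite mulNr; case: x z w => ? ? [? ?] [? ?]. Qed.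

Lemma Im_lin (x z w : C) : complex.Im (x * z + w) =
  complex.Re x * complex.Im z + complex.Im x * complex.Re z + complex.Im w.
Proof. by case: x z w => ? ? [? ?] [? ?]. Qed.

Lemma Lfun2P (f : B -> R) : f \in Lfun mu 2%:E <->
  measurable_fun setT f /\ (\int[mu]_x (f x ^+ 2)%:E < +oo)%E.
Proof.
split=> [/[dup] fL /Lfun2_integrable_sqr/integrableP[_]|[mf fi]].
  under eq_integral => x _ do rewrite gee0_abs ?lee_fin ?sqr_ge0 //=.
  by move: fL; rewrite inE => /andP[]; rewrite !inE.
rewrite inE; apply/andP; rewrite !inE /=; split=> //.
rewrite /finite_norm unlock /Lnorm poweR_lty //.
rewrite (eq_integral (fun x => (f x ^+ 2)%:E)) // => x _.
by rewrite /= powR_mulrn // real_normK // num_real.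
Qed.

Lemma square_integrableP f : square_integrable f <->
  (fun x => complex.Re (f x)) \in Lfun mu 2%:E /\
  (fun x => complex.Im (f x)) \in Lfun mu 2%:E.
Proof.
have intE : measurable_fun setT (fun x => complex.Re (f x)) ->
    measurable_fun setT (fun x => complex.Im (f x)) ->
    (\int[mu]_x (complex.Re (`|f x| ^+ 2))%:E =
     \int[mu]_x (complex.Re (f x) ^+ 2)%:E
     + \int[mu]_x (complex.Im (f x) ^+ 2)%:E)%E.
  move=> mR mI.
  rewrite -ge0_integralD //; [by apply: eq_integral => x _; rewrite Re_normc2| | | |].
  - by move=> x _; rewrite lee_fin sqr_ge0.
  - by apply/measurable_EFinP; apply: measurable_funX.
  - by move=> x _; rewrite lee_fin sqr_ge0.
  - by apply/measurable_EFinP; apply: measurable_funX.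
rewrite !Lfun2P; split=> [[mR mI]|[[mR fR] [mI fI]]]; last first.
  by split=> //; rewrite intE // lte_add_pinfty.
rewrite intE // => fi; split; split=> //; apply: le_lt_trans fi.
  by rewrite leeDl // integral_ge0 // => x _; rewrite lee_fin sqr_ge0.
by rewrite leeDr // integral_ge0 // => x _; rewrite lee_fin sqr_ge0.
Qed.

End SquareIntegrable.

Section L2fun.
Context {d : measure_display} {B : measurableType d} {R : realType}.
Variable mu : {measure set B -> \bar R}.
Local Notation C := (Cx R).

Definition l2fun_pred : {pred B -> C} := [pred f | `[< square_integrable mu f >]].

Record l2fun : Type := L2fun { l2fun_fun :> B -> C ; _ : l2fun_fun \in l2fun_pred }.

HB.instance Definition _ := [isSub for l2fun_fun].
HB.instance Definition _ := [Choice of l2fun by <:].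

Lemma l2fun_predP f : reflect (square_integrable mu f) (f \in l2fun_pred).
Proof. exact: asboolP. Qed.

Lemma l2fun_submod_closed : submod_closed l2fun_pred.
Proof.
have [L0 LZD] := Lfun_submod_closed mu (lee1n 2).
have LD f g : f \in Lfun mu 2%:E -> g \in Lfun mu 2%:E -> f + g \in Lfun mu 2%:E.
  by move=> fL gL; rewrite -[f]scale1r; exact: LZD.
have LZ (a : R) f : f \in Lfun mu 2%:E -> a *: f \in Lfun mu 2%:E.
  by move=> fL; rewrite -[a *: f]addr0; exact: LZD.
split=> [|x f g].
  apply/l2fun_predP/square_integrableP; split; exact: L0.
move=> /l2fun_predP/square_integrableP[fR fI].
move=> /l2fun_predP/square_integrableP[gR gI].
apply/l2fun_predP/square_integrableP; split.
- rewrite (_ : (fun _ => _) = (complex.Re x *: (fun t => complex.Re (f t))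
     + (- complex.Im x) *: (fun t => complex.Im (f t)))
     + (fun t => complex.Re (g t))).
    by apply: (LD) => //; apply: (LD); exact: LZ.
  apply/funext => t; rewrite !fctE.
  exact: Re_lin.
- rewrite (_ : (fun _ => _) = (complex.Re x *: (fun t => complex.Im (f t))
     + complex.Im x *: (fun t => complex.Re (f t)))
     + (fun t => complex.Im (g t))).
    by apply: (LD) => //; apply: (LD); exact: LZ.
  apply/funext => t; rewrite !fctE.
  exact: Im_lin.
Qed.

HB.instance Definition _ :=
  GRing.isSubmodClosed.Build C (B -> C) l2fun_pred l2fun_submod_closed.
HB.instance Definition _ := [SubChoice_isSubLmodule of l2fun by <:].

Lemma l2fun_linE x (f g : l2fun) t : (x *: f + g) t = x * f t + g t.
Proof. by []. Qed.

Definition l2null : {pred l2fun} :=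
  [pred f : l2fun | `[< {ae mu, forall x, f x = 0 :> C} >]].

Lemma l2nullP (f : l2fun) : reflect {ae mu, forall x, f x = 0 :> C} (f \in l2null).
Proof. exact: asboolP. Qed.

Lemma l2null_submod_closed : submod_closed l2null.
Proof.
split=> [|x f g]; first by apply/l2nullP; exact: nearW.
move=> /l2nullP f0 /l2nullP g0; apply/l2nullP.
by apply: filterS2 f0 g0 => t ft gt; rewrite l2fun_linE ft gt mulr0 addr0.
Qed.

HB.instance Definition _ :=
  GRing.isSubmodClosed.Build C l2fun l2null l2null_submod_closed.

End L2fun.

Section L2.
Context {d : measure_display} {B : measurableType d} {R : realType}.
Variable mu : {measure set B -> \bar R}.
Local Notation C := (Cx R).

Local Open Scope quotient_scope.

Definition L2 : Type := Quotient.quot (@l2null _ _ _ mu).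
HB.instance Definition _ := Choice.on L2.
HB.instance Definition _ := EqQuotient.on L2.
HB.instance Definition _ := GRing.Zmodule.on L2.

(* A class is coerced to a chosen representative: its values are meaningful
   only up to almost-everywhere equality. *)
Definition L2_fun (f : L2) : B -> C := repr f.
Coercion L2_fun : L2 >-> Funclass.

Lemma L2P (f g : l2fun mu) :
  reflect {ae mu, forall x, f x = g x :> C} (\pi_L2 f == \pi_L2 g).
Proof.
rewrite -Quotient.idealrBE; apply: (iffP (l2nullP _)) => h.
  by apply: filterS h => x /subr0_eq.
by apply: filterS h => x /= E; apply/eqP; rewrite subr_eq0; apply/eqP.
Qed.

Lemma L2_pi_ae (f : l2fun mu) : {ae mu, forall x, L2_fun (\pi_L2 f) x = f x}.
Proof. by apply/L2P; rewrite reprK. Qed.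

Lemma pi_L2D : {morph \pi_L2 : f g / f + g >-> f + g}.
Proof. by move=> f g; exact: Quotient.pi_add. Qed.

Definition L2_scale (a : C) (f : L2) : L2 := \pi_L2 (a *: repr f).

Lemma pi_L2_scale a : {morph \pi_L2 : f / a *: f >-> L2_scale a f}.
Proof.
move=> f; apply/eqP/L2P; apply: filterS (L2_pi_ae f) => x E.
by congr (a * _); rewrite -[LHS]E.
Qed.

Lemma L2_ind (P : L2 -> Prop) : (forall f, P (\pi_L2 f)) -> forall f, P f.
Proof. by move=> h f; rewrite -[f]reprK; exact: h. Qed.

Lemma L2_scaleA a b (f : L2) : L2_scale a (L2_scale b f) = L2_scale (a * b) f.
Proof.
elim/L2_ind: f => f.
by rewrite -(pi_L2_scale b f) -(pi_L2_scale a (b *: f)) scalerA pi_L2_scale.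
Qed.

Lemma L2_scale1 : left_id 1 L2_scale.
Proof. by elim/L2_ind => f; rewrite -(pi_L2_scale 1 f) scale1r. Qed.

Lemma L2_scaleDr : right_distributive L2_scale +%R.
Proof.
move=> a; elim/L2_ind => f; elim/L2_ind => g.
rewrite -(pi_L2D f g) -(pi_L2_scale a f) -(pi_L2_scale a g).
by rewrite -(pi_L2_scale a (f + g)) scalerDr pi_L2D.
Qed.

Lemma L2_scaleDl (f : L2) : {morph L2_scale^~ f : a b / a + b}.
Proof.
elim/L2_ind: f => f a b.
rewrite -(pi_L2_scale a f) -(pi_L2_scale b f) -(pi_L2_scale (a + b) f).
by rewrite scalerDl pi_L2D.
Qed.

HB.instance Definition _ := GRing.Zmodule_isLmodule.Build C L2
  L2_scaleA L2_scale1 L2_scaleDr L2_scaleDl.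

Lemma L2_lin_ae a (f g : L2) :
  {ae mu, forall x, (a *: f + g : L2) x = a * f x + g x :> C}.
Proof.
have -> : a *: f + g = \pi_L2 (a *: repr f + repr g).
  by rewrite pi_L2D reprK.
by apply: filterS (L2_pi_ae (a *: repr f + repr g)) => x ->.
Qed.

Lemma L2_ae0 : {ae mu, forall x, (0 : L2) x = 0}.
Proof.
apply: filterS (L2_lin_ae (-1) 0 0) => x.
by rewrite scaler0 addr0 mulN1r addNr.
Qed.

Lemma L2_ae_eq (f g : L2) : {ae mu, forall x, f x = g x} -> f = g.
Proof. by move=> fg; rewrite -[f]reprK -[g]reprK; apply/eqP/L2P. Qed.

End L2.

Section L2inner.
Context {d : measure_display} {B : measurableType d} {R : realType}.
Variable mu : {measure set B -> \bar R}.
Local Notation C := (Cx R).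

Definition cintegrable (f : B -> C) :=
  mu.-integrable setT (EFin \o (fun x => complex.Re (f x))) /\
  mu.-integrable setT (EFin \o (fun x => complex.Im (f x))).

Lemma Cx_eq (z w : C) : complex.Re z = complex.Re w ->
  complex.Im z = complex.Im w -> z = w.
Proof. by case: z w => ? ? [? ?] /= -> ->. Qed.

Lemma Re_mulconj (z w : C) : complex.Re (z * w^*) =
  complex.Re z * complex.Re w + complex.Im z * complex.Im w.
Proof. by case: z w => ? ? [? ?] /=; rewrite mulrN opprK. Qed.

Lemma Im_mulconj (z w : C) : complex.Im (z * w^*) =
  (- complex.Re z) * complex.Im w + complex.Im z * complex.Re w.
Proof. by case: z w => ? ? [? ?] /=; rewrite mulrN mulNr. Qed.

Lemma cintegral_ae f g : cintegrable f -> cintegrable g ->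
  {ae mu, forall x, f x = g x} -> cintegral mu f = cintegral mu g.
Proof.
move=> [/integrableP[fR _] /integrableP[fI _]] [/integrableP[gR _] /integrableP[gI _]] fg.
rewrite /cintegral /Rintegral; congr (fine _ +i* fine _)%C.
  by apply: ae_eq_integral => //; apply: filterS fg => x /= -> _.
by apply: ae_eq_integral => //; apply: filterS fg => x /= -> _.
Qed.

Let RintegralL (a b c : R) (f g h : B -> R) :
  mu.-integrable setT (EFin \o f) -> mu.-integrable setT (EFin \o g) ->
  mu.-integrable setT (EFin \o h) ->
  mu.-integrable setT (EFin \o (fun x => a * f x + b * g x + c * h x)) /\
  \int[mu]_x (a * f x + b * g x + c * h x) =
  a * \int[mu]_x f x + b * \int[mu]_x g x + c * \int[mu]_x h x.
Proof.
move=> fi gi hi.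
have Z k u : mu.-integrable setT (EFin \o u) ->
    mu.-integrable setT (EFin \o (fun x : B => k * u x)).
  move=> ui; rewrite (_ : _ \o _ = (fun x => k%:E * (EFin \o u) x)%E) //.
  exact: integrableZl.
have D u v : mu.-integrable setT (EFin \o u) -> mu.-integrable setT (EFin \o v) ->
    mu.-integrable setT (EFin \o (fun x : B => u x + v x)).
  move=> ui vi; rewrite (_ : _ \o _ = (EFin \o u) \+ (EFin \o v))%E //.
  exact: integrableD.
have abi := D _ _ (Z a _ fi) (Z b _ gi).
split; first exact: D abi (Z c _ hi).
rewrite RintegralD //; last exact: Z.
by rewrite RintegralD // ?RintegralZl //; exact: Z.
Qed.

Lemma cintegral_lin a f g : cintegrable f -> cintegrable g ->
  cintegrable (fun x => a * f x + g x) /\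
  cintegral mu (fun x => a * f x + g x) = a * cintegral mu f + cintegral mu g.
Proof.
move=> [fR fI] [gR gI].
have [i1 e1] := RintegralL (complex.Re a) (- complex.Im a) 1 fR fI gR.
have [i2 e2] := RintegralL (complex.Re a) (complex.Im a) 1 fI fR gI.
have ER : (fun x => complex.Re (a * f x + g x)) = (fun x =>
    complex.Re a * complex.Re (f x) + - complex.Im a * complex.Im (f x)
    + 1 * complex.Re (g x)).
  by apply/funext => x; rewrite Re_lin mul1r.
have EI : (fun x => complex.Im (a * f x + g x)) = (fun x =>
    complex.Re a * complex.Im (f x) + complex.Im a * complex.Re (f x)
    + 1 * complex.Im (g x)).
  by apply/funext => x; rewrite Im_lin mul1r.
split; first by split; rewrite ?ER ?EI.
have -> : cintegral mu (fun x => a * f x + g x) =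
   ((\int[mu]_x complex.Re (a * f x + g x))
     +i* \int[mu]_x complex.Im (a * f x + g x))%C by [].
rewrite ER EI e1 e2 !mul1r.
by apply: Cx_eq; rewrite ?Re_lin ?Im_lin.
Qed.

Lemma cintegral_conj f : cintegrable f -> cintegrable (fun x => (f x)^*) /\
  cintegral mu (fun x => (f x)^*) = (cintegral mu f)^*.
Proof.
move=> [fR fI].
have [iR _] := RintegralL 0 0 1 fR fR fR.
have [iI eI] := RintegralL 0 0 (-1) fI fI fI.
have ER : (fun x => complex.Re (f x)^*) = (fun x => complex.Re (f x)).
  by apply/funext => x; case: (f x).
have EI : (fun x => complex.Im (f x)^*) = (fun x =>
    0 * complex.Im (f x) + 0 * complex.Im (f x) + -1 * complex.Im (f x)).
  by apply/funext => x; rewrite !mul0r !add0r mulN1r; case: (f x).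
split; first by split; rewrite ?ER ?EI.
apply: Cx_eq; first by rewrite [LHS]/= ER.
by rewrite [LHS]/= EI eI !mul0r !add0r mulN1r.
Qed.

Definition L2_inner (f g : L2 mu) : C := cintegral mu (fun x => f x * (g x)^*).

Lemma L2_square_integrable (f : L2 mu) : square_integrable mu f.
Proof. exact/l2fun_predP/(valP (repr f : l2fun mu)). Qed.

Lemma L2_cintegrable (f g : L2 mu) : cintegrable (fun x => f x * (g x)^*).
Proof.
have /square_integrableP[fR fI] := L2_square_integrable f.
have /square_integrableP[gR gI] := L2_square_integrable g.
have RR := (Lfun1_integrable _ _).1 (Lfun2_mul_Lfun1 fR gR).
have II := (Lfun1_integrable _ _).1 (Lfun2_mul_Lfun1 fI gI).
have RI := (Lfun1_integrable _ _).1 (Lfun2_mul_Lfun1 fR gI).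
have IR := (Lfun1_integrable _ _).1 (Lfun2_mul_Lfun1 fI gR).
split.
  have [+ _] := RintegralL 1 1 0 RR II RR; congr (_.-integrable _ (_ \o _)).
  by apply/funext => x; rewrite Re_mulconj !mul1r mul0r addr0.
have [+ _] := RintegralL (-1) 1 0 RI IR RI; congr (_.-integrable _ (_ \o _)).
by apply/funext => x; rewrite Im_mulconj mulN1r mul1r mul0r addr0 mulNr.
Qed.

Lemma L2_inner_linear a f g h :
  L2_inner (a *: f + g) h = a * L2_inner f h + L2_inner g h.
Proof.
have [i1 <-] := cintegral_lin a (L2_cintegrable f h) (L2_cintegrable g h).
apply: cintegral_ae => //; first exact: L2_cintegrable.
by apply: filterS (L2_lin_ae a f g) => x ->; rewrite mulrDl mulrA.
Qed.

Lemma L2_innerC f g : L2_inner f g = (L2_inner g f)^*.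
Proof.
have [_ <-] := cintegral_conj (L2_cintegrable g f).
by congr (cintegral mu _); apply/funext => x; rewrite rmorphM /= conjCK mulrC.
Qed.

Lemma L2_inner_sqr f :
  L2_inner f f = (\int[mu]_x (complex.Re (`|f x| ^+ 2)))%:C%C.
Proof.
apply: Cx_eq.
  rewrite -[RHS]/(\int[mu]_x (complex.Re (`|f x| ^+ 2))).
  rewrite -[LHS]/(\int[mu]_x (complex.Re (f x * (f x)^*))).
  by congr (Rintegral mu _ _); apply/funext => x; rewrite normCK.
rewrite -[RHS]/(0 : R) -[LHS]/(\int[mu]_x (complex.Im (f x * (f x)^*))).
rewrite (_ : (fun _ => _) = (fun=> 0)) ?/Rintegral ?integral0 //.
by apply/funext => x; rewrite Im_mulconj mulNr [X in - X]mulrC addNr.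
Qed.

Lemma L2_inner_ge0 f : 0 <= L2_inner f f.
Proof.
rewrite L2_inner_sqr ler0c Rintegral_ge0 // => x _.
by rewrite Re_normc2 addr_ge0 ?sqr_ge0.
Qed.

Lemma L2_inner_eq0 f : L2_inner f f = 0 -> f = 0.
Proof.
rewrite L2_inner_sqr => -[/eqP].
have [fi _] := L2_cintegrable f f.
have E : (fun x => complex.Re (f x * (f x)^*)) =
    (fun x => complex.Re (`|f x| ^+ 2)).
  by apply/funext => x; rewrite normCK.
rewrite E in fi; rewrite /Rintegral fine_eq0; last exact: integrable_fin_num.
have /integrableP[fm _] := fi.
move=> /eqP f0.
have /(ae_eq_integral_abs mu measurableT fm) fae :
    (\int[mu]_x `|(complex.Re (`|f x| ^+ 2))%:E|)%E = 0.
  rewrite -[RHS]f0; apply: eq_integral => x _; rewrite gee0_abs // lee_fin.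
  by rewrite Re_normc2 addr_ge0 ?sqr_ge0.
apply: L2_ae_eq; apply: filterS2 fae (L2_ae0 mu) => x /(_ I) + ->.
move=> h; have := EFin_inj h; rewrite Re_normc2 => /eqP.
rewrite paddr_eq0 ?sqr_ge0 // !sqrf_eq0 => /andP[/eqP zr /eqP zi].
exact: Cx_eq.
Qed.

End L2inner.

HB.instance Definition _ {d : measure_display} {B : measurableType d} {R : realType}
    (mu : {measure set B -> \bar R}) :=
  Lmodule_isPreHilbert.Build (Cx R) (L2 mu)
  (@L2_inner_linear _ _ _ mu) (@L2_innerC _ _ _ mu) (@L2_inner_ge0 _ _ _ mu)
  (@L2_inner_eq0 _ _ _ mu).

Section Operators.
Variables (C : numClosedFieldType) (U V : preHilbertType C).

Definition is_isometry (W : U -> V) := forall u, `|W u| = `|u|.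

Definition is_adjoint (W : U -> V) (Wstar : V -> U) :=
  forall u v, inner (W u) v = inner u (Wstar v).

End Operators.

(* Projections in a Hilbert space are orthogonal: idempotent and self-adjoint. *)
Definition is_projection (C : numClosedFieldType) (V : preHilbertType C)
  (P : V -> V) := P \o P =1 P /\ is_adjoint P P.

(* Main.v *)
Require Import Defs.
From HB Require Import structures.
From mathcomp Require Import all_boot all_order all_algebra.
From mathcomp Require Import complex ring lra.
From mathcomp Require Import all_classical all_reals all_analysis.
From mathcomp Require Import measurable_realfun.
Import Order.TTheory GRing.Theory Num.Theory.
Import numFieldNormedType.Exports.

Set Implicit Arguments.
Unset Strict Implicit.
Unset Printing Implicit Defensive.

Local Open Scope classical_set_scope.
Local Open Scope ring_scope.

(** The statement holds for every complete inner product space H in place of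
    the L2 space, and for every family k with <k_s, k_t> = K(s, t).  The finite
    combinations of the k_s and of the K_s then have the same Gram matrices, so
    W must send a limit of combinations of the K_s to the limit of the
    corresponding combinations of the k_s, which exists because H is complete.

    The proof reaches W through its adjoint.  For v in H let V v be the
    function s |-> <v, k_s>.  That V v lies in the reproducing kernel space is
    the main point ([exists_kapprox_inner]).  Combinations u_n of the k_s whose
    distance to v tends to the infimum delta of such distances converge to the
    orthogonal projection of v, which has the same inner products with the k_s
    as v.  Subtracting delta^2 x y^* from the inner product of x v + a and
    y v + b leaves a semi-inner product on pairs (scalar, combination), for
    which the vectors v - u_n tend to 0 in seminorm.  Its triangle inequality
    shows that (u_n) is Cauchy, and its Cauchy-Schwarz inequality that
    <v - u_n, k_t> tends to 0, which is the pointwise convergence required.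

    Then W f is the vector with <W f, v> = <f, V v> for all v
    ([exists_transform_adjoint]); it exists because H is complete and
    combinations of kernel functions are dense ([kapprox_cvg]).  Linearity of W, V W = 1 (from
    V k_s = K_s), the isometry property and the projection property all follow
    from this adjunction, and uniqueness of W follows from density.

    It remains to know that the L2 space is complete ([L2_complete], the
    Riesz-Fischer theorem): a Cauchy sequence has a subsequence whose distances
    decrease geometrically, such a subsequence converges almost everywhere, and
    Fatou's lemma turns this into convergence in mean square. *)

(** * Mean-square limits of real functions *)

Lemma cvgn_EFin (R : realType) (u : nat -> R) (l : R) :
  u @ \oo --> l -> (fun n => (u n)%:E) @ \oo --> l%:E.
Proof. by move=> ul; apply: cvg_EFin => //; exact: nearW. Qed.

Lemma sum_geometric_half (R : realType) :
  (\sum_(0 <= n <oo) ((2^-1 : R) ^+ n)%:E = 2%:E)%E.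
Proof.
apply/cvg_lim => //.
have h : `|2^-1 : R| < 1 by rewrite ger0_norm; lra.
have := @cvg_geometric_series R 1 _ h.
have -> : 1 / (1 - 2^-1) = 2 :> R by field.
move=> /cvgn_EFin; apply: cvg_trans.
rewrite (_ : (fun n => _) = (fun n => (series (geometric 1 2^-1) n)%:E)) //.
by apply/funext => n; rewrite sumEFin; congr EFin; apply: eq_bigr => i _; rewrite /= mul1r.
Qed.

(** The increments are absolutely summable since |y| <= p^-1 + p y^2, used
    with y the increment and p = 2 ^ n. *)
Lemma cvgn_summable_sqr (R : realType) (x : nat -> R) :
  (\sum_(0 <= n <oo) (2 ^+ n * (x n.+1 - x n) ^+ 2)%:E < +oo)%E ->
  cvgn x.
Proof.
move=> fin.
have w0 n : 0 <= 2 ^+ n * (x n.+1 - x n) ^+ 2 by rewrite mulr_ge0 ?sqr_ge0 ?exprn_ge0.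
have wc : cvgn (series (fun n => 2 ^+ n * (x n.+1 - x n) ^+ 2)).
  apply: nondecreasing_is_cvgn; first by apply: nondecreasing_series => n _ _.
  exists (fine (\sum_(0 <= n <oo) (2 ^+ n * (x n.+1 - x n) ^+ 2)%:E)%E).
  move=> _ [n _ <-]; rewrite -lee_fin fineK; last first.
    by rewrite ge0_fin_numE // nneseries_ge0 // => k _ _; rewrite lee_fin.
  by rewrite /series /= -sumEFin nneseries_lim_ge // => k _ _; rewrite lee_fin.
have gc : cvgn (series (geometric 1 (2^-1 : R))).
  by apply: is_cvg_geometric_series; rewrite ger0_norm; lra.
have dc : cvgn (series (telescope x)).
  apply: (@normed_cvg _ R^o); apply: series_le_cvg (is_cvg_seriesD gc wc) => n //.
  - exact: normr_ge0.
  - by apply: addr_ge0 => //; rewrite /= mul1r exprn_ge0 ?invr_ge0.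
  rewrite -[leRHS]/(geometric 1 2^-1 n + 2 ^+ n * (x n.+1 - x n) ^+ 2) /= mul1r /telescope.
  set y := x n.+1 - x n; set p : R := 2 ^+ n.
  have p0 : 0 < p by rewrite exprn_gt0.
  rewrite exprVn -/p -real_normK ?num_real //.
  have -> : p^-1 + p * `|y| ^+ 2 = `|y| + p^-1 * ((p * `|y| - 2^-1) ^+ 2 + 3 / 4).
    by field; rewrite gt_eqF.
  by rewrite lerDl mulr_ge0 ?addr_ge0 ?sqr_ge0 ?invr_ge0 ?ler0n // ltW.
have -> : x = (fun n => x 0%N + series (telescope x) n).
  by apply/funext => n; exact: eq_sum_telescope.
by apply: is_cvgD => //; exact: is_cvg_cst.
Qed.

Section MeanSquareLimit.
Context {d : measure_display} {B : measurableType d} {R : realType}.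
Variable mu : {measure set B -> \bar R}.

Lemma measurable_sqrB (u v : B -> R) :
  measurable_fun setT u -> measurable_fun setT v ->
  measurable_fun setT (fun x => ((u x - v x) ^+ 2)%:E).
Proof.
move=> mu_ mv; apply/measurable_EFinP; apply: measurable_funX.
exact: measurable_funB.
Qed.

(** The rate 4 ^ -n leaves room for the weights 2 ^ n: the weighted sum of the
    squared increments still has a finite integral, hence is almost everywhere
    finite, which makes the sequence converge almost everywhere.  The bounds
    pass to the limit by Fatou's lemma. *)
Lemma rapid_L2_limit (f : nat -> B -> R) :
  (forall n, measurable_fun setT (f n)) ->
  (forall n m, (n <= m)%N ->
    (\int[mu]_x ((f m x - f n x) ^+ 2)%:E <= ((4^-1 : R) ^+ n)%:E)%E) ->
  exists2 g : B -> R, measurable_fun setT g & forall n,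
    (\int[mu]_x ((g x - f n x) ^+ 2)%:E <= ((4^-1 : R) ^+ n)%:E)%E.
Proof.
move=> mf fI.
pose w n x := (2 ^+ n * (f n.+1 x - f n x) ^+ 2)%:E.
have w0 n x : (0 <= w n x)%E by rewrite lee_fin mulr_ge0 ?sqr_ge0 ?exprn_ge0.
have mw n : measurable_fun setT (w n).
  rewrite (_ : w n = fun x => ((2 ^+ n)%:E * ((f n.+1 x - f n x) ^+ 2)%:E)%E) //.
  by apply: emeasurable_funM => //; exact: measurable_sqrB.
have wI n : (\int[mu]_x w n x <= ((2^-1 : R) ^+ n)%:E)%E.
  rewrite (_ : w n = fun x => ((2 ^+ n)%:E * ((f n.+1 x - f n x) ^+ 2)%:E)%E) //.
  rewrite ge0_integralZl_EFin ?exprn_ge0 //; first last.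
  - exact: measurable_sqrB.
  - by move=> x _; rewrite lee_fin sqr_ge0.
  apply: le_trans (lee_wpmul2l _ (fI n n.+1 (leqnSn n))) _.
    by rewrite lee_fin exprn_ge0.
  by rewrite -EFinM lee_fin -exprMn (_ : 2 * 4^-1 = 2^-1 :> R) //; field.
have wi : mu.-integrable setT (fun x => (\sum_(0 <= n <oo) w n x)%E).
  apply/integrableP; split.
    by apply: ge0_emeasurable_sum.
  under eq_integral => x _ do rewrite gee0_abs ?nneseries_ge0 //.
  rewrite integral_nneseries //.
  apply: le_lt_trans (ltry 2); rewrite -sum_geometric_half.
  by apply: lee_nneseries => // n _ _; exact: integral_ge0.
have cv : {ae mu, forall x, cvgn (f ^~ x)}.
  apply: filterS (integrable_ae measurableT wi) => x /(_ I) h.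
  by apply: cvgn_summable_sqr; rewrite ltey_eq h.
(* The upper limit is a measurable function also where the sequence diverges. *)
pose g x := fine (limn_esup (fun n => (f n x)%:E)).
have mg : measurable_fun setT g.
  apply: measurableT_comp; first exact: fine_measurable.
  by apply: measurable_fun_limn_esup => n; exact/measurable_EFinP.
exists g => // n.
pose q m x := ((f m x - f n x) ^+ 2)%:E.
have q0 m x : (0 <= q m x)%E by rewrite lee_fin sqr_ge0.
have mq m : measurable_fun setT (q m) by exact: measurable_sqrB.
rewrite (@ge0_ae_eq_integral _ _ _ mu setT _ (fun x => limn_einf (q ^~ x))) //.
- apply: le_trans (fatou mu measurableT mq _) _ => //.
  rewrite limn_einf_lim; apply: lime_le; first exact: is_cvg_einfs.
  apply: nearW => m.
  apply: (@le_trans _ _ (\int[mu]_x q (maxn m n) x)%E).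
    by apply: ereal_inf_lbound; exists (maxn m n) => //=; exact: leq_maxl.
  by apply: fI; exact: leq_maxr.
- exact: measurable_sqrB.
- rewrite (_ : (fun x => _) = (fun x => (- limn_esup (-%E \o q ^~ x))%E)).
    apply: measurableT_comp => //.
    by apply: measurable_fun_limn_esup => m; exact: measurableT_comp.
  by apply/funext => x; rewrite limn_esupN oppeK.
- by move=> x _; rewrite lee_fin sqr_ge0.
- move=> x _; rewrite limn_einf_lim; apply: lime_ge; first exact: is_cvg_einfs.
  by apply: nearW => m; apply: le_ereal_inf_tmp => _ [k _ <-].
- apply: filterS cv => x /cvg_ex[l fl] _.
  have gl : g x = l.
    by rewrite /g (cvg_limn_einf_sup (cvgn_EFin fl)).2.
  rewrite gl; symmetry; apply: (cvg_limn_einf_sup _).1.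
  apply: cvgn_EFin; rewrite expr2; under eq_fun do rewrite expr2.
  by apply: cvgM; apply: cvgB => //; exact: cvg_cst.
Qed.

End MeanSquareLimit.

(** * Inner product spaces *)

Section InnerTheory.
Variables (C : numClosedFieldType) (H : preHilbertType C).
Implicit Types u v w : H.

Lemma inner0l w : inner (0 : H) w = 0.
Proof.
have := inner_linear (-1) (0 : H) 0 w.
by rewrite scaler0 addr0 mulN1r addNr.
Qed.

Lemma innerZl a u w : inner (a *: u) w = a * inner u w.
Proof. by rewrite -[a *: u]addr0 inner_linear inner0l addr0. Qed.

Lemma innerDl u v w : inner (u + v) w = inner u w + inner v w.
Proof. by rewrite -[u]scale1r inner_linear mul1r scale1r. Qed.

Lemma innerBl u v w : inner (u - v) w = inner u w - inner v w.
Proof. by rewrite innerDl -scaleN1r innerZl mulN1r. Qed.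

Lemma inner_ge0 u : 0 <= inner u u.
Proof. by rewrite inner_norm exprn_ge0. Qed.

Lemma norm_inner u : `|u| = sqrtC (inner u u).
Proof. by rewrite inner_norm sqrCK. Qed.

Lemma inner_CauchySchwarz u v : `|inner u v| <= `|u| * `|v|.
Proof.
rewrite !norm_inner.
exact: (form_CauchySchwarz (@inner_linear C H) (@innerC C H) inner_ge0).
Qed.

Lemma inner_injr u v : (forall w, inner u w = inner v w) -> u = v.
Proof.
move=> uv; apply/subr0_eq/eqP; rewrite -normr_eq0 -sqrf_eq0.
by rewrite -inner_norm innerBl uv subrr.
Qed.

End InnerTheory.

Lemma inner_cvgl (R : realType) (H : preHilbertType (Cx R)) (u : nat -> H) l v :
  u @ \oo --> l -> (fun n => inner (u n) v : (Cx R)^o) @ \oo --> (inner l v : (Cx R)^o).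
Proof.
move=> /cvgrPdist_lt ul; apply/cvgCP => e e0.
have v1 : 0 < `|v| + 1 by rewrite ltr_wpDl.
have [|N _ h] := ul (e / (`|v| + 1)); first by rewrite divr_gt0.
exists N => n /h; rewrite ltr_pdivlMr // => /(le_lt_trans _); apply.
rewrite -innerBl; apply: le_trans (inner_CauchySchwarz _ _) _.
by rewrite ler_wpM2l ?lerDl.
Qed.

Definition norm_complete (C : numClosedFieldType) (H : preHilbertType C) :=
  forall u : nat -> H, (forall e : C, 0 < e -> exists N, forall m n,
    (N <= m)%N -> (N <= n)%N -> `|u m - u n| < e) ->
  exists l : H, u @ \oo --> l.

Lemma continuous_isometry (C : numClosedFieldType) (U W : preHilbertType C)
    (T : {linear U -> W}) :
  is_isometry T -> continuous T.
Proof.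
move=> Ti x; apply/cvgrPdist_lt => e e0; near=> y.
rewrite -linearB Ti; near: y; exact: cvgr_dist_lt.
Unshelve. all: by end_near.
Qed.

Lemma linear_bundle (C : pzRingType) (U V : lmodType C) (f : U -> V) :
  (forall a u v, f (a *: u + v) = a *: f u + f v) ->
  exists g : {linear U -> V}, g =1 f.
Proof.
move=> fl; pose fM := GRing.isLinear.Build C U V *:%R f fl.
by exists (HB.pack_for {linear U -> V} f fM).
Qed.

Lemma Re_ge0 (R : realType) (z : Cx R) : 0 <= z -> 0 <= complex.Re z.
Proof. by rewrite lecE => /andP[]. Qed.

Lemma RRe_ge0 (R : realType) (z : Cx R) : 0 <= z -> z = ((complex.Re z)%:C)%C.
Proof. by rewrite lecE => /andP[/eqP z0 _]; apply: Cx_eq; rewrite //= z0. Qed.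

Lemma exists_invn_lt (R : realType) (e : Cx R) : 0 < e -> exists N : nat, N.+1%:R^-1 < e.
Proof.
move=> e0; have e1 : 0 < complex.Re e by move: e0; rewrite ltcE => /andP[].
have [N _ /(_ N (leqnn _))/= h] := near_infty_natSinv_lt (PosNum e1).
exists N; rewrite [e]RRe_ge0 ?(ltW e0) // -ltcR in h *.
by move: h; rewrite fmorphV rmorph_nat.
Qed.

(** * The adjoint transform *)

Section Transform.
Variables (R : realType) (S : Type) (K : S -> S -> Cx R).
Hypothesis hK : positive_definite K.
Local Notation C := (Cx R).
Variables (H : preHilbertType C) (k : S -> H).
Hypothesis hk : forall s t, inner (k s) (k t) = K s t.
Implicit Types a b : seq (C * S).

Definition lcomb a : H := \sum_(p <- a) p.1 *: k p.2.

Lemma lcomb_lin x a b : lcomb (klin x a b) = x *: lcomb a + lcomb b.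
Proof.
rewrite /lcomb big_cat big_map /= scaler_sumr; congr (_ + _).
by apply: eq_bigr => p _; rewrite scalerA.
Qed.

Lemma lcomb1 s : lcomb [:: (1, s)] = k s.
Proof. by rewrite /lcomb big_cons big_nil addr0 scale1r. Qed.

Lemma lcomb0 : lcomb [::] = 0.
Proof. exact: big_nil. Qed.

Lemma inner_lcombl a v : inner (lcomb a) v = \sum_(p <- a) p.1 * inner (k p.2) v.
Proof.
elim: a => [|p a IHa]; first by rewrite lcomb0 inner0l big_nil.
by rewrite /lcomb !big_cons inner_linear IHa.
Qed.

Lemma inner_lcomb_k a t : inner (lcomb a) (k t) = kcomb K a t.
Proof. by rewrite inner_lcombl; apply: eq_bigr => p _; rewrite hk. Qed.

Lemma inner_lcomb a b : inner (lcomb a) (lcomb b) = kform K a b.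
Proof.
rewrite innerC inner_lcombl kform_comb rmorph_sum; apply: eq_bigr => q _.
by rewrite rmorphM /= -innerC inner_lcomb_k.
Qed.

Lemma norm_lcomb a : `|lcomb a| = knorm K a.
Proof. by rewrite norm_inner inner_lcomb. Qed.

Lemma norm_lcombB a b : `|lcomb a - lcomb b| = knorm K (klin (-1) b a).
Proof. by rewrite -norm_lcomb lcomb_lin scaleN1r addrC. Qed.

Section Residual.
Variable v : H.

Let D : set R := [set complex.Re (`|v - lcomb a| ^+ 2) | a in setT].

Let D_has_inf : has_inf D.
Proof.
split; first by exists (complex.Re (`|v - lcomb [::]| ^+ 2)), [::].
by exists 0 => _ [a _ <-]; rewrite Re_ge0 ?exprn_ge0.
Qed.

Let dist_le a : ((inf D)%:C)%C <= `|v - lcomb a| ^+ 2.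
Proof.
rewrite [leRHS]RRe_ge0 ?exprn_ge0 // lecR.
by apply: ge_inf; [exact: D_has_inf.2 | exists a].
Qed.

Let dist_approx (e : C) : 0 < e -> exists a, `|v - lcomb a| ^+ 2 < ((inf D)%:C)%C + e.
Proof.
move=> e0; have e1 : 0 < complex.Re e by move: e0; rewrite ltcE => /andP[].
have [_ [a _ <-] h] := inf_adherent e1 D_has_inf; exists a.
rewrite [ltLHS]RRe_ge0 ?exprn_ge0 // [e]RRe_ge0 ?(ltW e0) //.
by rewrite -rmorphD ltcR.
Qed.

(** The semi-inner product below lives on pairs rather than on H because the
    coefficient of v cannot be read off the vector when v is itself a
    combination. *)
Let vec (p : C * seq (C * S)) : H := p.1 *: v + lcomb p.2.

Let pcomb (c : C) (p q : C * seq (C * S)) := (c * p.1 + q.1, klin c p.2 q.2).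

(** The correction makes the squared seminorm of v - a the excess of |v - a|^2
    over its infimum, while pairs with scalar 0 keep the norm of H. *)
Let form (p q : C * seq (C * S)) : C :=
  inner (vec p) (vec q) - ((inf D)%:C)%C * (p.1 * (q.1)^*).

Let vec_comb c p q : vec (pcomb c p q) = c *: vec p + vec q.
Proof.
by rewrite /vec lcomb_lin /= scalerDl scalerDr scalerA addrACA.
Qed.

Let form_lin c p q r : form (pcomb c p q) r = c * form p r + form q r.
Proof. by rewrite /form vec_comb inner_linear /=; ring. Qed.

Let formC p q : form p q = (form q p)^*.
Proof.
rewrite /form rmorphB rmorphM /= -innerC rmorphM /= conjCK.
rewrite [q.1^* * _]mulrC; congr (_ - _ * _).
by apply: Cx_eq; rewrite //= oppr0.
Qed.

(** For c != 0, the vector c v + a is c times the difference of v and a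
    combination, so its squared norm is at least |c|^2 inf D. *)
Let form_ge0 p : 0 <= form p p.
Proof.
case: p => c a; rewrite /form subr_ge0 inner_norm /vec /=.
have [->|c0] := eqVneq c 0; first by rewrite mul0r mulr0 exprn_ge0.
have -> : c *: v + lcomb a = c *: (v - lcomb (klin (- c^-1) a [::])).
  by rewrite lcomb_lin lcomb0 addr0 scaleNr opprK scalerDr scalerA divff ?scale1r.
by rewrite normrZ exprMn -normCK mulrC ler_wpM2l ?exprn_ge0.
Qed.

Let resid a : C * seq (C * S) := (1, klin (-1) a [::]).

Let vec_resid a : vec (resid a) = v - lcomb a.
Proof. by rewrite /vec scale1r lcomb_lin lcomb0 addr0 scaleN1r. Qed.

Let resid_small (e : C) : 0 < e -> exists a, sqrtC (form (resid a) (resid a)) < e.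
Proof.
move=> e0; have [|a h] := @dist_approx (e ^+ 2); first by rewrite exprn_gt0.
exists a; rewrite -(@ltr_pXn2r _ 2) ?nnegrE ?sqrtC_ge0 ?(ltW e0) // sqrtCK.
by rewrite /form vec_resid inner_norm conjC1 !mulr1 ltrBlDl.
Qed.

(** For combinations u_n minimizing the distance to v, the vectors v - u_n tend
    to 0 in the seminorm of [form]: the triangle inequality for this seminorm
    gives the Cauchy property and its Cauchy-Schwarz inequality the pointwise
    limit. *)
Lemma exists_kapprox_inner : exists u, kapprox K u (fun s => inner v (k s)).
Proof.
have /choice[u uP] n : exists a,
    sqrtC (form (resid a) (resid a)) < (n.+1%:R^-1 : C).
  by apply: resid_small; rewrite invr_gt0 ltr0Sn.
have us (e : C) : 0 < e -> exists N, forall n, (N <= n)%N ->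
    sqrtC (form (resid (u n)) (resid (u n))) < e.
  move=> /exists_invn_lt[N hN]; exists N => n Nn.
  apply: lt_trans (uP n) _; apply: le_lt_trans hN.
  by rewrite lef_pV2 ?posrE ?ltr0Sn // ler_nat.
exists u; split=> [e e0|t].
  have [|N h] := us (e / 2); first by rewrite divr_gt0.
  exists N => m n Nm Nn.
  have -> : knorm K (klin (-1) (u n) (u m)) =
      sqrtC (form (pcomb (-1) (resid (u m)) (resid (u n)))
                  (pcomb (-1) (resid (u m)) (resid (u n)))).
    rewrite /form vec_comb !vec_resid /= mulr1 addNr mul0r mulr0 subr0.
    rewrite -norm_lcombB -norm_inner; congr `|_|.
    by rewrite scaleN1r opprB addrA subrK.
  apply: le_lt_trans (form_norm_comb form_lin formC form_ge0 _ _ _) _.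
  by rewrite normrN normr1 mul1r [ltRHS]splitr ltrD ?h.
apply/cvgCP => e e0.
pose q : C * seq (C * S) := (0, [:: (1, t)]).
have q0 : 0 < sqrtC (form q q) + 1 by rewrite ltr_wpDl // sqrtC_ge0.
have [|N h] := us (e / (sqrtC (form q q) + 1)); first by rewrite divr_gt0.
exists N => n /h; rewrite ltr_pdivlMr // => /(le_lt_trans _); apply.
have -> : inner v (k t) - kcomb K (u n) t = form (resid (u n)) q.
  rewrite /form vec_resid /vec /= conjC0 !mulr0 subr0 scale0r add0r lcomb1.
  by rewrite innerBl inner_lcomb_k.
apply: le_trans (form_CauchySchwarz form_lin formC form_ge0 _ _) _.
by rewrite ler_wpM2l ?lerDl // sqrtC_ge0.
Qed.

End Residual.

Lemma transform_subproof v : (fun s => inner v (k s)) \in rkhs_pred K.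
Proof. exact/rkhs_predP/exists_kapprox_inner. Qed.

Definition transform (v : H) : rkhs hK := Rkhs hK (transform_subproof v).

Lemma transformE v s : transform v s = inner v (k s).
Proof. by []. Qed.

Lemma transform_lin c v w : transform (c *: v + w) = c *: transform v + transform w.
Proof. by apply/val_inj/funext => s /=; rewrite inner_linear. Qed.

Lemma transform_k s : transform (k s) = kernel_fun hK s.
Proof. by apply/val_inj/funext => t /=; rewrite hk. Qed.

End Transform.

(** * Density of the combinations of kernel functions *)

Section Density.
Variables (R : realType) (S : Type) (K : S -> S -> Cx R).
Hypothesis hK : positive_definite K.
Local Notation C := (Cx R).
Implicit Types a b : seq (C * S).

Lemma inner_kernel_fun s t : inner (kernel_fun hK s) (kernel_fun hK t) = K s t.
Proof. by rewrite -rkhs_reproducing. Qed.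

Lemma kcauchy_lcomb (H : preHilbertType C) (k : S -> H) u :
  (forall s t, inner (k s) (k t) = K s t) -> kcauchy K u ->
  forall e : C, 0 < e -> exists N, forall m n, (N <= m)%N -> (N <= n)%N ->
    `|lcomb k (u m) - lcomb k (u n)| < e.
Proof.
move=> hk uc e /uc[N h]; exists N => m n Nm Nn.
by rewrite (norm_lcombB hk) h.
Qed.

(** With n fixed, f - u_n is approximated by the sequence u_m - u_n in m, whose
    norms are eventually small by the Cauchy property. *)
Lemma kapprox_cvg u (f : rkhs hK) :
  kapprox K u f -> (fun n => lcomb (kernel_fun hK) (u n)) @ \oo --> f.
Proof.
move=> uf; apply/cvgrPdist_lt => e e0.
have e20 : 0 < e / 2 by rewrite divr_gt0.
have [N h] := uf.1 (e / 2) e20; exists N => // n /= Nn.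
have fnE t : (f - lcomb (kernel_fun hK) (u n)) t = - kcomb K (u n) t + f t.
  rewrite [LHS]rkhs_reproducing innerBl (inner_lcomb_k inner_kernel_fun).
  by rewrite -rkhs_reproducing addrC.
have gP : kapprox K (fun m => klin (-1) (u n) (u m))
    (f - lcomb (kernel_fun hK) (u n)).
  split=> [c /uf.1[M hM]|t].
    exists M => m p Mm Mp; rewrite (_ : knorm K _ = knorm K (klin (-1) (u p) (u m))) ?hM //.
    rewrite -!(norm_lcomb inner_kernel_fun) !lcomb_lin; congr `|_|.
    by rewrite scalerDr !scalerA mulrNN mulr1 scale1r !scaleN1r addrACA subrr add0r.
  rewrite fnE; apply: cvgC_ext => [m|]; first by rewrite kcomb_lin mulN1r.
  by apply: cvgD; [exact: cvg_cst | exact: uf.2].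
rewrite -(@ltr_pXn2r _ 2) ?nnegrE ?(ltW e0) // -inner_norm.
apply: (@le_lt_trans _ _ ((e / 2) ^+ 2)); last first.
  by rewrite ltr_pXn2r ?nnegrE ?(ltW e20) ?(ltW e0) // gtr_pMr // invf_lt1 ?ltr1n.
rewrite -subr_ge0 addrC -mulN1r.
have := rkhs_inner_cvg gP gP.
move=> /(cvgC_lin (x := -1)) /(_ (cvg_cst ((e / 2) ^+ 2))).
(* Only the terms of index at least N are known to be below e / 2. *)
rewrite -(cvg_shiftn N) => /cvgC_ge0; apply => m.
rewrite /= mulN1r addrC subr_ge0 -[leLHS]sqrtCK.
by rewrite ler_pXn2r ?nnegrE ?knorm_ge0 ?(ltW e20) // ltW // h // leq_addl.
Qed.

End Density.

Lemma continuous_kernel_ext (R : realType) (S : Type) (K : S -> S -> Cx R)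
    (hK : positive_definite K) (W : preHilbertType (Cx R))
    (T T' : {linear rkhs hK -> W}) :
  continuous T -> continuous T' ->
  (forall s, T (kernel_fun hK s) = T' (kernel_fun hK s)) -> T =1 T'.
Proof.
move=> Tc T'c TT' f.
have uf := kapprox_cvg (rkhs_approxP f).
have E a : T (lcomb (kernel_fun hK) a) = T' (lcomb (kernel_fun hK) a).
  by rewrite !linear_sum; apply: eq_bigr => p _; rewrite !linearZ TT'.
have TL : (fun n => T (lcomb (kernel_fun hK) (rkhs_approx f n))) @ \oo --> T f.
  by apply: cvg_comp uf _; exact: Tc.
have T'L : (fun n => T (lcomb (kernel_fun hK) (rkhs_approx f n))) @ \oo --> T' f.
  rewrite (_ : (fun n => _) = T' \o (fun n => lcomb (kernel_fun hK) (rkhs_approx f n))).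
    by apply: cvg_comp uf _; exact: T'c.
  by apply/funext => n; exact: E.
exact: (cvg_unique (@norm_hausdorff _ W) TL T'L).
Qed.

(** * The isometry into a complete space *)

Section KernelIsometry.
Variables (R : realType) (S : Type) (K : S -> S -> Cx R).
Variable hK : positive_definite K.
Local Notation C := (Cx R).
Variables (H : preHilbertType C) (k : S -> H).
Hypothesis hk : forall s t, inner (k s) (k t) = K s t.
Hypothesis complete_H : norm_complete H.

Local Notation V := (transform hK hk).

Lemma lcomb_transform a v : inner (lcomb k a) v = inner (lcomb (kernel_fun hK) a) (V v).
Proof.
rewrite !inner_lcombl; apply: eq_bigr => p _; congr (_ * _).
by rewrite innerC [RHS]innerC -rkhs_reproducing.
Qed.

(** The vector is the limit of the combinations of the k_s with the coefficients
    of an approximation of f.  The adjunction holds for combinations, and both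
    sides of it pass to the limit. *)
Lemma exists_transform_adjoint (f : rkhs hK) :
  exists w : H, forall v, inner w v = inner f (V v).
Proof.
have [w uw] := complete_H (kcauchy_lcomb hk (rkhs_approxP f).1).
exists w => v; apply: cvgC_unique (inner_cvgl (v := v) uw) _.
apply: cvgC_ext => [n|]; first exact: lcomb_transform.
exact: inner_cvgl (kapprox_cvg (rkhs_approxP f)).
Qed.

Theorem kernel_isometry :
  exists W : {linear rkhs hK -> H},
    [/\ continuous W,
        forall s : S, W (kernel_fun hK s) = k s,
        forall W' : {linear rkhs hK -> H}, continuous W' ->
          (forall s : S, W' (kernel_fun hK s) = k s) -> W' =1 W &
        is_isometry W] /\
    exists V : {linear H -> rkhs hK},
      [/\ is_adjoint W V,
          forall (f : H) (s : S), V f s = inner f (k s),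
          V \o W =1 id &
          is_projection (W \o V)].
Proof.
have /choice[w wV] := exists_transform_adjoint.
have [V' V'E] := linear_bundle (transform_lin hK hk).
have [|W WE] := @linear_bundle _ _ _ w.
  move=> c f g; apply: inner_injr => v.
  by rewrite inner_linear !wV inner_linear.
have adj : is_adjoint W V' by move=> f v; rewrite WE V'E wV.
have VW : V' \o W =1 id.
  move=> f; apply/val_inj/funext => s /=.
  rewrite V'E transformE WE wV transform_k.
  by rewrite -rkhs_reproducing.
have Wi : is_isometry W.
  move=> f; rewrite !norm_inner adj; congr (sqrtC (inner _ _)); exact: VW.
have Wk s : W (kernel_fun hK s) = k s.
  apply: inner_injr => v.
  by rewrite adj V'E innerC -rkhs_reproducing transformE -innerC.
exists W; split.
  split=> //; first exact: continuous_isometry.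
  move=> W' W'c W'k; apply: continuous_kernel_ext => //.
    exact: continuous_isometry.
  by move=> s; rewrite Wk.
exists V'; split=> //; first by move=> f s; rewrite V'E.
split=> [v|u v] /=; first by congr (W _); exact: VW.
by rewrite adj [inner u _]innerC adj -innerC.
Qed.

End KernelIsometry.

(** * Completeness of the L2 space *)

Section L2Complete.
Context {d : measure_display} {B : measurableType d} {R : realType}.
Variable mu : {measure set B -> \bar R}.
Local Notation C := (Cx R).
Implicit Types F G : L2 mu.

Lemma L2_measurable F : measurable_fun setT (fun x => complex.Re (F x)) /\
  measurable_fun setT (fun x => complex.Im (F x)).
Proof. by have [? ? _] := L2_square_integrable F. Qed.

Lemma L2_normB F G :
  ((complex.Re (`|F - G| ^+ 2))%:E =
   \int[mu]_x ((complex.Re (F x) - complex.Re (G x)) ^+ 2)%:E +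
   \int[mu]_x ((complex.Im (F x) - complex.Im (G x)) ^+ 2)%:E)%E.
Proof.
have [mFR mFI] := L2_measurable F; have [mGR mGI] := L2_measurable G.
have [mR mI fin] := L2_square_integrable (F - G).
have -> : `|F - G| ^+ 2 = L2_inner (F - G) (F - G) by rewrite -inner_norm.
rewrite L2_inner_sqr -[complex.Re _]/(fine (\int[mu]_x _)) fineK; last first.
  rewrite ge0_fin_numE // integral_ge0 // => x _.
  by rewrite lee_fin Re_ge0 ?exprn_ge0.
rewrite -ge0_integralD //; first last.
- exact: measurable_sqrB.
- by move=> x _; rewrite lee_fin sqr_ge0.
- exact: measurable_sqrB.
- by move=> x _; rewrite lee_fin sqr_ge0.
apply: ge0_ae_eq_integral => //.
- apply/measurable_EFinP; under eq_fun do rewrite Re_normc2.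
  by apply: measurable_funD; exact: measurable_funX.
- by apply: emeasurable_funD; exact: measurable_sqrB.
- by move=> x _; rewrite lee_fin Re_ge0 ?exprn_ge0.
- by move=> x _; rewrite -EFinD lee_fin addr_ge0 ?sqr_ge0.
apply: filterS (L2_lin_ae (-1) G F) => x + _.
rewrite scaleN1r addrC => ->; rewrite mulN1r addrC Re_normc2 -EFinD.
by case: (F x) (G x) => ? ? [? ?].
Qed.

(** A subsequence along which the squared distances are below 4 ^ -k has
    mean-square limits of its real and imaginary parts; the Cauchy property
    carries the convergence over to the whole sequence. *)
Lemma L2_complete : norm_complete (L2 mu).
Proof.
move=> F Fc.
pose h k : R := (4^-1) ^+ k.
have h0 k : 0 <= h k by rewrite exprn_ge0 ?invr_ge0.
have /choice[N NP] k : exists N, forall m n, (N <= m)%N -> (N <= n)%N ->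
    complex.Re (`|F m - F n| ^+ 2) <= h k.
  have [|N hN] := Fc (((2^-1) ^+ k)%:C)%C; first by rewrite ltcR exprn_gt0 ?invr_gt0.
  exists N => m n Nm Nn; rewrite -lecR -RRe_ge0 ?exprn_ge0 //.
  have -> : ((h k)%:C)%C = ((((2^-1) ^+ k)%:C)%C : C) ^+ 2.
    by rewrite -rmorphXn -exprM mulnC exprM; congr (_%:C)%C; congr (_ ^+ _); field.
  by rewrite ler_pXn2r ?nnegrE ?ler0c ?exprn_ge0 ?invr_ge0 // ltW // hN.
(* The summand k makes phi unbounded; the sum puts phi m beyond N k for every
   k <= m, so that F o phi has the geometric rate from each index on. *)
pose phi k := (k + \sum_(i < k.+1) N i)%N.
have phiN k m : (k <= m)%N -> (N k <= phi m)%N.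
  move=> km; rewrite /phi (bigD1 (Ordinal (km : (k < m.+1)%N))) //=.
  by rewrite addnCA leq_addr.
have phi_ge k : (k <= phi k)%N by exact: leq_addr.
pose f k : L2 mu := F (phi k).
have fI k m : (k <= m)%N -> ((complex.Re (`|f m - f k| ^+ 2))%:E <= (h k)%:E)%E.
  by move=> km; rewrite lee_fin NP // phiN.
have I0 (u : B -> R) : (0 <= \int[mu]_x ((u x) ^+ 2)%:E)%E.
  by apply: integral_ge0 => x _; rewrite lee_fin sqr_ge0.
have [a ma aP] : exists2 g : B -> R, measurable_fun setT g & forall n,
    (\int[mu]_x ((g x - complex.Re (f n x)) ^+ 2)%:E <= (h n)%:E)%E.
  apply: rapid_L2_limit => [n|n m nm]; first exact: (L2_measurable _).1.
  by apply: le_trans (fI _ _ nm); rewrite L2_normB leeDl.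
have [b mb bP] : exists2 g : B -> R, measurable_fun setT g & forall n,
    (\int[mu]_x ((g x - complex.Im (f n x)) ^+ 2)%:E <= (h n)%:E)%E.
  apply: rapid_L2_limit => [n|n m nm]; first exact: (L2_measurable _).2.
  by apply: le_trans (fI _ _ nm); rewrite L2_normB leeDr.
have inL (g u : B -> R) n : measurable_fun setT g -> u \in Lfun mu 2%:E ->
    (\int[mu]_x ((g x - u x) ^+ 2)%:E <= (h n)%:E)%E -> g \in Lfun mu 2%:E.
  move=> mg uL gu; have [_ LD] := Lfun_submod_closed mu (lee1n 2).
  rewrite (_ : g = 1 *: (g \- u) + u).
    apply: LD => //; apply/Lfun2P; split.
      by apply: measurable_funB => //; have /Lfun2P[] := uL.
    exact: le_lt_trans gu (ltry _).
  by apply/funext => x; rewrite !fctE scale1r subrK.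
have sq : square_integrable mu (fun x => (a x +i* b x)%C : C).
  have /square_integrableP[fR fIm] := L2_square_integrable (f 0).
  by apply/square_integrableP; split; [exact: inL (aP 0) | exact: inL (bP 0)].
have sqP : (fun x => (a x +i* b x)%C : C) \in l2fun_pred mu by exact/l2fun_predP.
pose G : L2 mu := \pi_(L2 mu)%qT (L2fun sqP).
have GE : {ae mu, forall x, G x = (a x +i* b x)%C :> C} by exact: L2_pi_ae.
have Gf k : complex.Re (`|G - f k| ^+ 2) <= h k *+ 2.
  rewrite -lee_fin L2_normB mulr2n EFinD.
  have [mGR mGI] := L2_measurable G; have [mfR mfI] := L2_measurable (f k).
  apply: leeD; [apply: le_trans (aP k)|apply: le_trans (bP k)];
    rewrite le_eqVlt; apply/orP; left; apply/eqP; apply: ge0_ae_eq_integral => //;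
    try (by move=> x _; rewrite lee_fin sqr_ge0); try exact: measurable_sqrB;
    by apply: filterS GE => x -> _.
exists G; apply/cvgrPdist_lt => e e0.
have e20 : 0 < e / 2 by rewrite divr_gt0.
have [M hM] := Fc _ e20.
have /cvgrPdist_lt hc : h @ \oo --> 0.
  by apply: cvg_expr; rewrite ger0_norm; lra.
have e21 : 0 < complex.Re (e / 2) by move: e20; rewrite ltcE => /andP[].
have [|N' _ hN'] := hc (complex.Re (e / 2) ^+ 2 / 2); first by rewrite divr_gt0 ?exprn_gt0.
exists M => // n /= Mn.
pose j := maxn M N'.
rewrite -[G](subrK (f j)) -addrA; apply: le_lt_trans (ler_normD _ _) _.
rewrite [ltRHS]splitr ltrD //; last first.
  by apply: hM => //; apply: leq_trans (phi_ge j); exact: leq_maxl.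
rewrite -(@ltr_pXn2r _ 2) ?nnegrE ?(ltW e20) //.
rewrite [ltLHS]RRe_ge0 ?exprn_ge0 // [e / 2]RRe_ge0 ?(ltW e20) //.
rewrite -rmorphXn ltcR; apply: le_lt_trans (Gf j) _.
have := hN' j (leq_maxr _ _).
by rewrite sub0r normrN ger0_norm // ltr_pdivlMr // mulr_natr.
Qed.

End L2Complete.

Theorem proposition2p1 (R : realType) (S : Type) (K : S -> S -> Cx R)
    (hK : positive_definite K)
    (d : measure_display) (B : measurableType d) (mu : probability B R)
    (k : S -> L2 mu)
    (hk : forall s t : S, K s t = cintegral mu (fun x => k s x * (k t x)^*)) :
  exists W : {linear rkhs hK -> L2 mu},
    [/\ continuous W,
        forall s : S, W (kernel_fun hK s) = k s,
        forall W' : {linear rkhs hK -> L2 mu}, continuous W' ->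
          (forall s : S, W' (kernel_fun hK s) = k s) -> W' =1 W &
        is_isometry W] /\
    exists V : {linear L2 mu -> rkhs hK},
      [/\ is_adjoint W V,
          forall (f : L2 mu) (s : S),
            V f s = cintegral mu (fun x => f x * (k s x)^*),
          V \o W =1 id &
          is_projection (W \o V)].
Proof.
have hk' s t : inner (k s) (k t) = K s t by rewrite hk.
exact: kernel_isometry hk' (@L2_complete _ _ _ mu).
Qed.
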